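(* A completable queue implementation has no $\mathsf{VRepet}$ violations if and only if for every value $v$ and all $n,m,k\in\mathbb{N}$ with $0<n<m$, the program $$\mathit{Prg}(v,n,m,k)=\big(\underbrace{\mathtt{enq}(v)\,\|\,\cdots\,\|\,\mathtt{enq}(v)}_{n}\ \|\ \underbrace{\mathtt{deq}(v)\,\|\,\cdots\,\|\,\mathtt{deq}(v)}_{m}\ \|\ \underbrace{C\,\|\,\cdots\,\|\,C}_{k}\big),\qquad C=\bigsqcup_{x\neq v}\mathtt{enq}(x)\ \sqcup\ \bigsqcup_{x\neq v}\mathtt{deq}(x),$$ has no execution trace in which more than $n$ of the $\mathtt{deq}(v)$ threads terminate.
   Context: A queue implementation provides methods $\mathtt{enq}(x)$ and $\mathtt{deq}()$ acting on shared state; its executions are interleavings of atomic steps of threads (execution traces), each inducing a history of invocation and response actions of $\mathtt{enq}$/$\mathtt{deq}$ events. A completion of a history $c$ is a complete history obtained from $c\cdot c'$, with $c'$ consisting only of response actions, by deleting the actions of still-pending events; the implementation is completable if for each induced history $c$ some completion of $c$ is itself an induced history. For a value $v$, $\mathtt{deq}(v)$ denotes the dequeue method instrumented with a prophecy of its result: it behaves exactly as $\mathtt{deq}()$ except that it diverges (never terminates) whenever $\mathtt{deq}()$ would return a value other than $v$, so that the traces of $\bigsqcup_{x}\mathtt{deq}(x)$ (over $x\in\mathbb{N}\cup\{\mathtt{NULL}\}$) are exactly those of $\mathtt{deq}()$. Here $\sqcup$ is nondeterministic choice (union of trace sets) and $\|$ is parallel composition: each component is a thread executing once, all threads interleaved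 over one shared instance of the implementation started from its initial state. The implementation has a $\mathsf{VRepet}$ violation if some induced history contains, for some value $v\neq\mathtt{NULL}$, more completed dequeue events returning $v$ than enqueue events of $v$ (so two dequeues must return the value inserted by the same enqueue).
   Formalization: A VRepet violation is additionally required to contain at least one enqueue of v; without this the claim fails, e.g. for an implementation whose enq does nothing and whose deq returns 7 once and NULL afterwards. *)

(* Defs.v *)
From Stdlib Require List.
From mathcomp Require Import all_boot.

Set Implicit Arguments.
Unset Strict Implicit.
Unset Printing Implicit Defensive.

(** * Queue implementations *)

(* A dequeue result is an [option nat], [None] being NULL. *)
Inductive meth := Enq of nat | Deq.

(* The code of the two methods, as a transition system of atomic steps on the
   shared state and the local state of one call.  Steps see neither the
   identity of the calling thread nor data kept from its earlier calls: calls
   communicate only through the shared state.  Steps may be nondeterministic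
   or blocking. *)
Record queue_impl := QueueImpl {
  shared : Type;
  local : Type;
  init : shared;
  entry : meth -> local;
  step : shared -> local -> shared -> local -> Prop;
  enq_ret : local -> Prop;
  deq_ret : local -> option nat -> Prop
}.

(** * Histories *)

Inductive act := Inv of meth | ResEnq | ResDeq of option nat.

(* An event is identified by a thread number and the rank of the call among
   the calls of that thread; this pairs invocations with responses. *)
Definition eid : Type := (nat * nat)%type.

Definition history := seq (eid * act).

Definition is_inv (a : act) : bool := if a is Inv _ then true else false.
Definition is_res (a : act) : bool := ~~ is_inv a.

Definition answers (m : meth) (a : act) : bool :=
  match m, a with
  | Enq _, ResEnq => true
  | Deq, ResDeq _ => true
  | _, _ => false
  end.

Definition well_formed_event (s : seq act) : bool :=
  match s with
  | [::] => true
  | [:: Inv _] => true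
  | [:: Inv m; a] => answers m a
  | _ => false
  end.

Definition well_formed (h : history) : Prop :=
  forall e : eid, well_formed_event [seq x.2 | x <- h & x.1 == e].

Definition pending (h : history) (e : eid) : bool :=
  has (fun x => (x.1 == e) && is_inv x.2) h
  && ~~ has (fun x => (x.1 == e) && is_res x.2) h.

Definition completion (h h' : history) : Prop :=
  exists r : history,
    [/\ all (fun x => is_res x.2) r,
        well_formed (h ++ r) &
        h' = [seq x <- h ++ r | ~~ pending (h ++ r) x.1]].

Definition nb_enq (v : nat) (h : history) : nat :=
  count (fun x => if x.2 is Inv (Enq w) then w == v else false) h.

Definition nb_deq (v : nat) (h : history) : nat :=
  count (fun x => if x.2 is ResDeq r then r == Some v else false) h.

(** * Programs *)

(* [DeqAs r] is the dequeue method with the prophecy that it returns [r]. *)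
Inductive call := Plain of meth | DeqAs of option nat.

Definition meth_of (c : call) : meth :=
  match c with Plain m => m | DeqAs _ => Deq end.

(* A thread is given by the set of call sequences it may perform, and a
   program is the parallel composition of a list of threads. *)
Definition tprog := seq call -> Prop.
Definition program := seq tprog.

Definition once (c : call) : tprog := fun w => w = [:: c].

Definition choice2 (T1 T2 : tprog) : tprog := fun w => T1 w \/ T2 w.

Definition choice_over (X : Type) (P : X -> Prop) (T : X -> tprog) : tprog :=
  fun w => exists2 x, P x & T x w.

Section Semantics.
Variable I : queue_impl.

(* [rank] is the number of calls already completed, [cur] the call in progress
   with its local state, and [todo] the calls not yet invoked. *)
Record thread := Thread {
  rank : nat;
  cur : option (call * local I);
  todo : seq call
}.

Definition start (w : seq call) : thread := Thread 0 None w.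

Definition terminated (th : thread) : bool :=
  match cur th, todo th with None, [::] => true | _, _ => false end.

(* Where [Deq] would return a value other than [r], [DeqAs r] has no response.
   Its divergence is an idle loop that changes neither the shared state nor the
   history, so it is left out of the traces; this makes the traces of the
   choice of [DeqAs r] over all [r] those of [Deq]. *)
Definition returns (c : call) (l : local I) (a : act) : Prop :=
  match c with
  | Plain (Enq _) => a = ResEnq /\ enq_ret l
  | Plain Deq => exists2 r, a = ResDeq r & deq_ret l r
  | DeqAs r => a = ResDeq r /\ deq_ret l r
  end.

Inductive tstep : shared I -> thread -> option act -> shared I -> thread -> Prop :=
| Tinv s j c w :
    tstep s (Thread j None (c :: w)) (Some (Inv (meth_of c)))
          s (Thread j (Some (c, entry I (meth_of c))) w)
| Tstep s l s' l' j c w :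
    step s l s' l' ->
    tstep s (Thread j (Some (c, l)) w) None s' (Thread j (Some (c, l')) w)
| Tres s l j c w a :
    returns c l a ->
    tstep s (Thread j (Some (c, l)) w) (Some a) s (Thread j.+1 None w).

Definition config : Type := (shared I * seq thread)%type.

(* Each step of a trace records the event it belongs to and, unless it is an
   internal step, the invocation or response action performed. *)
Definition trace := seq (eid * option act).

Inductive cstep : config -> eid * option act -> config -> Prop :=
| Cstep s s' ts1 th th' ts2 o :
    tstep s th o s' th' ->
    cstep (s, ts1 ++ th :: ts2) ((size ts1, rank th), o)
          (s', ts1 ++ th' :: ts2).

Inductive run : config -> trace -> config -> Prop :=
| Rnil g : run g [::] g
| Rcons g1 g2 g3 x tr : cstep g1 x g2 -> run g2 tr g3 -> run g1 (x :: tr) g3.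

(* [g] is the configuration reached at the end of the (finite) trace [tr]. *)
Definition execution (P : program) (tr : trace) (g : config) : Prop :=
  exists2 ws : seq (seq call),
    List.Forall2 (fun (T : tprog) w => T w) P ws &
    run (init I, map start ws) tr g.

Definition history_of (tr : trace) : history :=
  pmap (fun x => omap (pair x.1) x.2) tr.

(* The most general client: [N] threads, each performing an arbitrary sequence
   of uninstrumented calls. *)
Definition client (N : nat) : program :=
  nseq N (fun w => exists ms : seq meth, w = map Plain ms).

Definition induced (h : history) : Prop :=
  exists N tr g, execution (client N) tr g /\ h = history_of tr.

Definition completable : Prop :=
  forall h, induced h -> exists2 h', completion h h' & induced h'.

(* Some enqueue of [v] is required: two dequeues then have to share the value
   of one enqueue.  Returning a value that was never enqueued is a different
   kind of violation. *)
Definition VRepet : Prop :=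
  exists h v, induced h /\ 0 < nb_enq v h < nb_deq v h.

End Semantics.

Definition noise (v : nat) : tprog :=
  choice2 (choice_over (fun x => x <> v) (fun x => once (Plain (Enq x))))
          (choice_over (fun r => r <> Some v) (fun r => once (DeqAs r))).

Definition Prg (v n m k : nat) : program :=
  nseq n (once (Plain (Enq v))) ++ nseq m (once (DeqAs (Some v)))
    ++ nseq k (noise v).

(* The threads of [Prg v n m k] numbered [n] to [n + m - 1] are the [deq(v)]
   threads. *)
Definition nb_deq_terminated (I : queue_impl) (n m : nat) (g : config I) : nat :=
  count (@terminated I) (take m (drop n g.2)).

(* Main.v *)
(* Steps do not see thread identities, so the calls of a client run can be
   redistributed to one thread each without changing the shared state.  Running
   backwards through a client run, one learns the result of each completed
   dequeue before its invocation, hence its prophecy; a dequeue that stays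
   pending never reaches its response and may prophesy NULL.  Sorting the
   threads gives an execution of [Prg v n m k] with [n] and [m] the numbers of
   enqueues of [v] and of dequeues returning [v].  Conversely, forgetting the
   prophecies turns an execution of [Prg v n m k] into a client run; if it
   contains no enqueue of [v], an extra client thread invokes one. *)
From Stdlib Require List.
From Stdlib Require Import Permutation.
Require Import Defs.
From mathcomp Require Import all_boot zify.

Set Implicit Arguments.
Unset Strict Implicit.
Unset Printing Implicit Defensive.

(** * Counting calls on a value, and lists *)

Definition enq_call (v : nat) (c : call) : bool :=
  if meth_of c is Enq w then w == v else false.

Definition deq_call (v : nat) (c : call) : bool :=
  if c is DeqAs r then r == Some v else false.

Lemma nb_enq_cons v x tr :
  nb_enq v (history_of (x :: tr)) =
  (if x.2 is Some (Inv (Enq w)) then w == v else false)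
  + nb_enq v (history_of tr).
Proof. by case: x => e [[[]||]|]. Qed.

Lemma nb_deq_cons v x tr :
  nb_deq v (history_of (x :: tr)) =
  (if x.2 is Some (ResDeq r) then r == Some v else false)
  + nb_deq v (history_of tr).
Proof. by case: x => e [[[]||]|]. Qed.

Lemma history_of_cat tr1 tr2 :
  history_of (tr1 ++ tr2) = history_of tr1 ++ history_of tr2.
Proof. exact: pmap_cat. Qed.

Lemma Forall2_nseq (T U : Type) (R : T -> U -> Prop) x (s : seq U) :
  List.Forall (R x) s -> List.Forall2 R (nseq (size s) x) s.
Proof. by elim=> //= y s' Rxy _ IH; constructor. Qed.

Lemma Forall2_nseqP (T U : Type) (R : T -> U -> Prop) n x (s : seq U) :
  List.Forall2 R (nseq n x) s -> size s = n /\ List.Forall (R x) s.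
Proof.
elim: n s => [|n IH] s /= H; inversion H; subst; first by split; constructor.
by case: (IH _ H4) => <- ?; split=> //; constructor.
Qed.

Lemma Forall_map_nseq (T U : Type) (f : T -> U) y (s : seq T) :
  List.Forall (fun x => f x = y) s -> map f s = nseq (size s) y.
Proof. by elim=> //= x s' -> _ ->. Qed.

Lemma Permutation_filterC (T : Type) (a : pred T) (s : seq T) :
  Permutation s (filter a s ++ filter (predC a) s).
Proof.
elim: s => //= x s IH; case: (a x) => /=; first exact: perm_skip.
exact: Permutation_cons_app.
Qed.

Lemma Forall_filter (T : Type) (P : T -> Prop) (a : pred T) (s : seq T) :
  List.Forall P s -> List.Forall (fun x => P x /\ a x) (filter a s).
Proof. by elim=> //= x s' Px _ IH; case: ifP => // ax; constructor. Qed.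

(** * Extending runs and forgetting prophecies *)

Section Runs.
Variable I : queue_impl.
Implicit Types (s : shared I) (th : thread I) (g : config I).

Lemma run_trans g1 g2 g3 tr1 tr2 :
  run g1 tr1 g2 -> run g2 tr2 g3 -> run g1 (tr1 ++ tr2) g3.
Proof. by elim=> // *; apply: Rcons; eauto. Qed.

(** The idle thread is added at the end, so the positions of the others, and with them the event
    identifiers in the trace, stay the same. *)
Lemma run_frame th g1 tr g2 : run g1 tr g2 ->
  run (g1.1, rcons g1.2 th) tr (g2.1, rcons g2.2 th).
Proof.
elim=> [g|g g' g'' x tr' st _ IH]; first exact: Rnil.
apply: Rcons IH; case: st => s s' ts1 th1 th1' ts2 o st /=.
by rewrite !rcons_cat /=; apply: Cstep.
Qed.

Definition plain (c : call) : call := Plain (meth_of c).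

Definition plain_thread th : thread I :=
  Thread (rank th) (omap (fun p => (plain p.1, p.2)) (cur th))
         (map plain (todo th)).

Lemma returns_plain c (l : local I) a : returns c l a -> returns (plain c) l a.
Proof. by case: c => // r [-> ?]; exists r. Qed.

(** The trace is unchanged: an invocation records only the method, and a plain dequeue may give
    every response that a prophesied one gives. *)
Lemma run_plain g1 tr g2 : run g1 tr g2 ->
  run (g1.1, map plain_thread g1.2) tr (g2.1, map plain_thread g2.2).
Proof.
elim=> [g|g g' g'' x tr' st _ IH]; first exact: Rnil.
apply: Rcons IH; case: st => s s' ts1 th th' ts2 o st /=.
rewrite !map_cat /= -(size_map plain_thread ts1).
rewrite -[rank th]/(rank (plain_thread th)); apply: Cstep.
case: st => [s0 j c w|s0 l s1 l' j c w st|s0 l j c w a ra].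
- exact: (Tinv s0 j (plain c)).
- exact: Tstep.
- exact/Tres/returns_plain.
Qed.

(** * Counting the calls that remain *)

Definition calls_left th : seq call :=
  (if cur th is Some p then [:: p.1] else [::]) ++ todo th.

(** [nb_enq] counts invocations and [nb_deq] counts responses, so a call in progress is already
    spent as an enqueue but still owed as a dequeue. *)
Definition enq_left v th := count (enq_call v) (todo th).
Definition deq_left v th := count (deq_call v) (calls_left th).

Lemma run_nb_enq v g1 tr g2 : run g1 tr g2 ->
  nb_enq v (history_of tr) + sumn (map (enq_left v) g2.2)
  = sumn (map (enq_left v) g1.2).
Proof.
elim=> // g g' g'' x tr' st _ IH; rewrite nb_enq_cons -addnA IH.
case: {IH} st => s s' ts1 th th' ts2 o' st /=.
rewrite !map_cat !sumn_cat /= addnCA; congr (_ + _).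
case: st => [s0 j c w|s0 l s1 l' j c w _|s0 l j c w a ra] //=.
- by rewrite /enq_left /= /enq_call addnA; case: (meth_of c).
- case: c ra => [[y|]|r] /=; first by case=> ->.
    by case=> r ->.
  by case=> ->.
Qed.

(** Equality can fail: a [Plain Deq] returning [v] raises [nb_deq] without using up a [deq_call]. *)
Lemma run_nb_deq v g1 tr g2 : run g1 tr g2 ->
  sumn (map (deq_left v) g1.2)
  <= nb_deq v (history_of tr) + sumn (map (deq_left v) g2.2).
Proof.
elim=> // g g' g'' x tr' st _ IH; rewrite nb_deq_cons -addnA.
apply: leq_trans (leq_add (leqnn _) IH).
case: {IH} st => s s' ts1 th th' ts2 o' st /=.
rewrite !map_cat !sumn_cat /= [leqRHS]addnCA leq_add2l addnA leq_add2r.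
case: st => [s0 j c w|s0 l s1 l' j c w _|s0 l j c w a ra] //=.
rewrite /deq_left /= leq_add2r.
case: c ra => [[y|]|r] //=; by case=> ->.
Qed.

(** The comparison is made position by position so that the final configuration can be cut into the
    same blocks of threads as the program. *)
Lemma run_deq_left v g1 tr g2 : run g1 tr g2 ->
  List.Forall2 (fun th th' => deq_left v th' <= deq_left v th) g1.2 g2.2.
Proof.
elim=> [g|g g' g'' x tr' st _ IH]; first by elim: g.2; constructor.
case: st IH => s s' ts1 th th' ts2 o st /=.
move/List.Forall2_app_inv_l=> [us1 [us [H1 [H2 ->]]]].
inversion H2 as [|x1 th'' l1 us2 H3 H4]; subst.
apply: List.Forall2_app => //; constructor=> //; apply: leq_trans H3 _.
by case: st => //= *; rewrite /deq_left /calls_left /= ?leq_addl.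
Qed.

Lemma Forall2_sumn (T U : Type) (f : T -> nat) (f' : U -> nat) (ss : seq T) (tt : seq U) :
  List.Forall2 (fun x y => f' y <= f x) ss tt ->
  sumn (map f' tt) <= sumn (map f ss).
Proof. by elim=> //= *; apply: leq_add. Qed.

Lemma terminated_deq_left v th : terminated th -> deq_left v th = 0.
Proof. by case: th => j [[c l]|] []. Qed.

Lemma terminated_bound v ts :
  List.Forall (fun th => deq_left v th <= 1) ts ->
  count (@terminated I) ts + sumn (map (deq_left v) ts) <= size ts.
Proof.
elim=> //= th ts' H _ IH.
have := @terminated_deq_left v th; case: (terminated th) => [->|_] //; lia.
Qed.

(** * From an execution of [Prg] to a repetition *)

Lemma VRepet_of_Prg v n m k tr g : 0 < n < m ->
  execution (Prg v n m k) tr g -> n < nb_deq_terminated n m g -> VRepet I.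
Proof.
case/andP=> n0 nm [ws Hws R] Hd.
case/List.Forall2_app_inv_l: Hws => wE [w' [HE [Hw' Ews]]].
case/List.Forall2_app_inv_l: Hw' => wD [wK [HD [HK Ew]]].
subst w' ws; have {}R : run (init I, map (@start I) (wE ++ wD ++ wK)) tr g := R.
have [sE {}HE] := Forall2_nseqP HE; have [sD {}HD] := Forall2_nseqP HD.
have [_ {}HK] := Forall2_nseqP HK.
have EE : sumn (map (enq_left v) (map (@start I) (wE ++ wD ++ wK))) = n.
  have -> : map (enq_left v) (map (@start I) (wE ++ wD ++ wK))
          = nseq n 1 ++ nseq (size wD) 0 ++ nseq (size wK) 0.
    rewrite -map_comp !map_cat; congr (_ ++ _); [|congr (_ ++ _)].
    - rewrite -sE; apply: Forall_map_nseq.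
      by apply: List.Forall_impl HE => w ->; rewrite /= /enq_left /= /enq_call /= eqxx.
    - by apply: Forall_map_nseq; apply: List.Forall_impl HD => w ->.
    - apply: Forall_map_nseq; apply: List.Forall_impl HK => w [[x xv ->]|[r _ ->]] //.
      by rewrite /= /enq_left /= /enq_call /=; move/eqP/negbTE: xv => ->.
  by rewrite !sumn_cat !sumn_nseq; lia.
have DE : map (deq_left v) (map (@start I) wE) = nseq (size wE) 0.
  by rewrite -map_comp; apply: Forall_map_nseq; apply: List.Forall_impl HE => w ->.
have DD : List.Forall (fun w => deq_left v (@start I w) = 1) wD.
  by apply: List.Forall_impl HD => w ->; rewrite /deq_left /= eqxx.
have DK : map (deq_left v) (map (@start I) wK) = nseq (size wK) 0.
  rewrite -map_comp; apply: Forall_map_nseq.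
  apply: List.Forall_impl HK => w [[x _ ->]|[r rv ->]] //.
  by rewrite /= /deq_left /=; move/eqP/negbTE: rv => ->.
have ub : nb_enq v (history_of tr) <= n.
  by rewrite -EE -(run_nb_enq v R) leq_addr.
(* The run starts with [m] calls [deq(v)] owed. Terminated threads owe none and each other [deq(v)]
   thread at most one, so there are at least as many responses [v] as terminated [deq(v)]
   threads. *)
have lb : n < nb_deq v (history_of tr).
  have := run_nb_deq v R; have := run_deq_left v R.
  rewrite /= !map_cat => /List.Forall2_app_inv_l [gE [g' [FE [Fg' Eg]]]].
  case/List.Forall2_app_inv_l: Fg' => gD [gK [FD [FK Eg']]]; subst g'.
  have szE : size gE = n.
    by rewrite -sE -(size_map (@start I)); apply/esym/(List.Forall2_length FE).
  have szD : size gD = m.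
    by rewrite -sD -(size_map (@start I)); apply/esym/(List.Forall2_length FD).
  move: Hd; rewrite /nb_deq_terminated Eg drop_size_cat // take_size_cat // => Hd.
  have := Forall2_sumn FE; have := Forall2_sumn FK.
  have : List.Forall (fun th => deq_left v th <= 1) gD.
    move: FD DD; clear; elim: wD gD => [|w wD IH] [|y gD] //= H; inversion H; subst.
    by move=> /List.Forall_cons_iff [E D]; constructor; [rewrite -E | apply: IH].
  move/terminated_bound; rewrite szD.
  rewrite !map_cat !sumn_cat DE DK -map_comp (Forall_map_nseq DD) !sumn_nseq sD.
  lia.
have startE ws : map plain_thread (map (@start I) ws)
               = map (@start I) (map (map plain) ws).
  by rewrite -!map_comp.
have Hcl (ws : seq (seq call)) :
    List.Forall2 (fun (T : tprog) w => T w) (client (size ws)) (map (map plain) ws).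
  rewrite -(size_map (map plain)); apply: Forall2_nseq.
  elim: ws => [|w ws IH] /=; constructor=> //; exists (map meth_of w).
  by rewrite -map_comp; apply: eq_map.
have R' := run_plain R; rewrite /= startE in R'.
case: (posnP (nb_enq v (history_of tr))) => [e0|pos]; last first.
  exists (history_of tr), v; split; last by rewrite pos /=; lia.
  exists (size (wE ++ wD ++ wK)), tr, (g.1, map plain_thread g.2); split=> //.
  by exists (map (map plain) (wE ++ wD ++ wK)); first exact: Hcl.
(* With no enqueue of [v] in the run, an extra client thread invokes one at the end; the count
   becomes 1, which is at most [n]. *)
have R2 := run_frame (@start I [:: Plain (Enq v)]) R'.
pose th := @Thread I 0 (Some (Plain (Enq v), entry I (Enq v))) [::].
pose ts := map plain_thread g.2.
have S : run (g.1, rcons ts (@start I [:: Plain (Enq v)]))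
    [:: ((size ts, 0), Some (Inv (Enq v)))] (g.1, rcons ts th).
  apply: Rcons (Rnil _); rewrite -!cats1.
  exact: (Cstep ts [::] (Tinv g.1 0 (Plain (Enq v)) [::])).
have R3 := run_trans R2 S.
exists (history_of (tr ++ [:: ((size ts, 0), Some (Inv (Enq v)))])), v.
split; last first.
  rewrite history_of_cat /nb_enq /nb_deq !count_cat.
  rewrite -/(nb_enq v (history_of tr)) -/(nb_deq v (history_of tr)) e0 /= eqxx /=; lia.
exists (size (rcons (wE ++ wD ++ wK) [:: Plain (Enq v)])); do 2!eexists; split; last by [].
exists (map (map plain) (rcons (wE ++ wD ++ wK) [:: Plain (Enq v)])); first exact: Hcl.
by rewrite !map_rcons; exact: R3.
Qed.

(** * Redistributing calls to separate threads *)

(* A call with the present and the final state of the thread that runs it. *)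
Definition item : Type := (call * (thread I * thread I))%type.

(** The trace is left existential because its event identifiers depend on thread positions. *)
Definition reach s (ps : seq item) : Prop :=
  exists tr s', run (s, map (fun p => p.2.1) ps) tr (s', map (fun p => p.2.2) ps).

(** Steps do not depend on positions, so each one is replayed by the same item in the permuted list.
    Pairing present and final threads makes both ends permute alike. *)
Lemma reach_perm s ps qs : Permutation ps qs -> reach s ps -> reach s qs.
Proof.
move=> + [tr [s' R]].
move: {1 2}(s, _) {1 2}(s', _) R (erefl (s, map (fun p : item => p.2.1) ps))
  (erefl (s', map (fun p : item => p.2.2) ps)) => g g' R.
elim: R s ps qs => {g tr g'} [g|g g' g'' x tr st _ IH] s ps qs E1 E2 pq.
  subst g; case: E2 => Es E2; exists [::], s; subst s'.
  suff -> : map (fun p => p.2.2) qs = map (fun p => p.2.1) qs by exact: Rnil.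
  apply/esym; have : List.Forall (fun p : item => p.2.1 = p.2.2) ps.
    by elim: ps E2 {pq} => //= p ps IH [? ?]; constructor; auto.
  by move/(Permutation_Forall pq); elim=> //= p ps' -> _ ->.
case: st E1 IH => s0 s1 ts1 th th' ts2 o st /= [? E1] IH; subst s0.
have [p1 [[c [u f]] [p2 [Eps Et1 Eu Et2]]]] :
    exists p1 p p2, [/\ ps = p1 ++ p :: p2, map (fun p : item => p.2.1) p1 = ts1,
      p.2.1 = th & map (fun p : item => p.2.1) p2 = ts2].
  elim: ts1 ps E1 {IH st E2 pq} => [|t ts1 IH] [|p ps] //= [-> E1].
    by exists [::], p, ps.
  by have [p1 [q [p2 [-> <- <- <-]]]] := IH _ E1; exists (p :: p1), q, p2.
rewrite /= in Eu; subst.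
have [q1 [q2 Eq]] : exists q1 q2, qs = q1 ++ (c, (th, f)) :: q2.
  by apply: List.in_split; apply: (Permutation_in _ pq); apply: List.in_elt.
subst qs.
have pq2 : Permutation (p1 ++ (c, (th', f)) :: p2) (q1 ++ (c, (th', f)) :: q2).
  apply: Permutation_elt; exact: Permutation_app_inv pq.
have [||tr' [s2 R]] := IH s1 _ _ _ _ pq2; rewrite ?map_cat //.
do 2!eexists; rewrite !map_cat /= in R *.
by apply: Rcons R; apply: Cstep st.
Qed.

Lemma reach_frame s c th ps : reach s ps -> reach s ((c, (th, th)) :: ps).
Proof.
case=> tr [s' /(run_frame th) /= R].
apply: (@reach_perm s (rcons ps (c, (th, th)))).
  by rewrite -cats1; apply/Permutation_sym/Permutation_cons_append.
by exists tr, s'; rewrite !map_rcons.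
Qed.

Lemma reach_step s s' c th th' f o ps : tstep s th o s' th' ->
  reach s' ((c, (th', f)) :: ps) -> reach s ((c, (th, f)) :: ps).
Proof.
move=> st [tr [s2 R]]; do 2!eexists; apply: Rcons R.
exact: (@Cstep I s s' [::] th th' _ o st).
Qed.

(** The call gets a fresh thread with nothing else to do; [c'] may differ from [c] in its
    prophecy. *)
Definition runs_call th (a : seq item) : Prop :=
  match cur th with
  | None => a = [::]
  | Some (c, l) => exists c' f,
      a = [:: (c', (Thread 0 (Some (c', l)) [::], f))] /\ meth_of c' = meth_of c
  end.

(** Every dequeue must carry a prophecy, and [v] is prophesied only for dequeues that do return. *)
Definition good_item v (p : item) : Prop :=
  p.1 <> Plain Deq /\ (deq_call v p.1 -> terminated p.2.2).

(** The prophecy is read off the response. *)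
Lemma resolve v c (l : local I) a : returns c l a ->
  exists c', [/\ meth_of c' = meth_of c, returns c' l a, c' <> Plain Deq &
    deq_call v c' = if a is ResDeq r then r == Some v else false].
Proof.
case: c => [[x|]|r] /=.
- by case=> -> H; exists (Plain (Enq x)).
- by case=> r -> H; exists (DeqAs r).
- by case=> -> H; exists (DeqAs r).
Qed.

(* [As] lists the calls in progress, thread by thread, and [B] the calls that
   the run has yet to invoke. *)
Lemma run_split v g tr g' : run g tr g' ->
  exists (As : seq (seq item)) (B : seq item),
    [/\ reach g.1 (flatten As ++ B), List.Forall2 runs_call g.2 As,
        List.Forall (fun p => p.2.1 = @start I [:: p.1]) B,
        List.Forall (good_item v) (flatten As ++ B) &
        count (enq_call v) (map fst B) = nb_enq v (history_of tr) /\
        count (deq_call v) (map fst (flatten As ++ B)) = nb_deq v (history_of tr)].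
Proof.
elim=> {g tr g'} [[s ts]|g g' g'' x tr st _ [As [B [Rch FA FB G [nE nD]]]]].
  have [As [FA E G D]] : exists As, [/\ List.Forall2 runs_call ts As,
      map (fun p => p.2.2) (flatten As) = map (fun p => p.2.1) (flatten As),
      List.Forall (good_item v) (flatten As) &
      count (deq_call v) (map fst (flatten As)) = 0].
    elim: ts => [|[j [[c l]|] w] ts [As [FA E G D]]].
    - by exists [::]; split=> //; constructor.
    (* A dequeue still pending at the end prophesies NULL, so it does not count as a [deq(v)]. *)
    - pose c' := if meth_of c is Enq x then Plain (Enq x) else DeqAs None.
      pose th := @Thread I 0 (Some (c', l)) [::].
      have Dc : deq_call v c' = false by rewrite /c'; case: (meth_of c).
      exists ([:: (c', (th, th))] :: As); split=> /=.
      + constructor=> //; exists c', th; split=> //.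
        by rewrite /c'; case: (meth_of c).
      + by rewrite E.
      + constructor=> //; split; rewrite ?Dc // /c'; by case: (meth_of c).
      + by rewrite Dc.
    - by exists ([::] :: As); split=> //; constructor.
  exists As, [::]; rewrite cats0; split=> //.
  by exists [::], s; rewrite E; apply: Rnil.
rewrite nb_enq_cons nb_deq_cons.
case: st FA Rch => s s' ts1 th th' ts2 o' st FA /= Rch.
case/List.Forall2_app_inv_l: FA => A1 [A' [F1 [FA' EA]]].
inversion FA' as [|x1 a l1 A2 Fa F2]; subst.
have fl b : flatten (A1 ++ b :: A2) ++ B = flatten A1 ++ b ++ flatten A2 ++ B.
  by rewrite flatten_cat /= -!catA.
rewrite fl in Rch G nD.
case: st Rch Fa => [s0 j c w|s0 l s1 l' j c w st|s0 l j c w r ra] Rch.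
- case=> c' [f [Ea Ec]]; subst a.
  (* Going back over an invocation, the call moves from [As] to [B], rewound to its start. *)
  pose p := (c', (@start I [:: c'], f)) : item.
  exists (A1 ++ [::] :: A2), (p :: B).
  have P y : Permutation (y :: flatten A1 ++ flatten A2 ++ B)
                         (flatten (A1 ++ [::] :: A2) ++ y :: B).
    rewrite flatten_cat /= -catA.
    rewrite !catA; apply: Permutation_cons_app; exact: Permutation_refl.
  split.
  + apply: reach_perm (P p) _.
    apply: (@reach_step _ s0 c' _ (Thread 0 (Some (c', entry I (meth_of c'))) [::])).
      exact: Tinv.
    rewrite Ec; apply: reach_perm Rch.
    exact/Permutation_sym/Permutation_middle.
  + by apply: List.Forall2_app => //; constructor.
  + by constructor.
  + apply: Permutation_Forall (P p) _.
    have := Permutation_Forall (Permutation_sym (Permutation_middle _ _ _)) G.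
    by move=> H; inversion H; constructor.
  + split.
      by rewrite /= nE /enq_call Ec; case: (meth_of c).
    rewrite -nD !flatten_cat /= !map_cat /= !count_cat /= !map_cat !count_cat /=; lia.
- case=> c' [f [Ea Ec]]; subst a.
  exists (A1 ++ [:: (c', (Thread 0 (Some (c', l)) [::], f))] :: A2), B.
  have P y : Permutation (y :: flatten A1 ++ flatten A2 ++ B)
                         (flatten A1 ++ [:: y] ++ flatten A2 ++ B).
    exact: Permutation_middle.
  rewrite fl; split=> //.
  + apply: reach_perm (P _) _; apply: reach_step (Tstep _ _ _ st) _.
    exact: reach_perm (Permutation_sym (P _)) Rch.
  + apply: List.Forall2_app => //; constructor=> //.
    by exists c', f.
  + apply: Permutation_Forall (P _) _.
    have := Permutation_Forall (Permutation_sym (P _)) G.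
    by move=> H; inversion H; constructor.
  + by split; rewrite // -nD !map_cat.
- move=> Ea; rewrite /runs_call /= in Ea; subst a.
  have [c' [Ec ra' nP Dc]] := resolve v ra.
  (* Going back over a response creates a new item; its thread, already terminated, stays idle
     during the rest of the run. *)
  pose f := @Thread I 1 None [::].
  exists (A1 ++ [:: (c', (Thread 0 (Some (c', l)) [::], f))] :: A2), B.
  have P y : Permutation (y :: flatten A1 ++ flatten A2 ++ B)
                         (flatten A1 ++ [:: y] ++ flatten A2 ++ B).
    exact: Permutation_middle.
  rewrite fl; split=> //.
  + apply: reach_perm (P _) _; apply: reach_step (Tres _ _ _ ra') _.
    exact: reach_frame.
  + apply: List.Forall2_app => //; constructor=> //.
    by exists c', f.
  + by apply: Permutation_Forall (P _) _; constructor.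
  + split.
      rewrite nE; case: c ra {Ec} => [[y|]|q] /=; first by case=> ->.
        by case=> q ->.
      by case=> ->.
    rewrite -nD !map_cat !count_cat /= Dc; case: r {ra ra' Dc} => *; lia.
Qed.

(** * From a repetition to an execution of [Prg] *)

Lemma Prg_of_VRepet : VRepet I ->
  exists v n m k, 0 < n < m /\
    exists tr (g : config I), execution (Prg v n m k) tr g /\ n < nb_deq_terminated n m g.
Proof.
case=> h [v [[N [tr [g [[ws _ R] ->]]]] Hnm]].
have [As [B [Rch FA FB G [nE nD]]]] := run_split v R.
(* No call is in progress at the start of a client run, so all calls lie in [B]. *)
have {FA} EA : flatten As = [::].
  move: FA => /=; elim: ws As {Rch G nD R} => [|w ws IH] As /= H; inversion H; subst=> //=.
  by rewrite H2 /= IH.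
rewrite EA /= in Rch G nD.
pose a (p : item) := enq_call v p.1; pose d (p : item) := deq_call v p.1.
have {FB}G : List.Forall (fun p => p.2.1 = @start I [:: p.1] /\ good_item v p) B.
  by elim: FB G => //= p B' Hp _ IH H; inversion H; constructor; auto.
(* The calls are sorted into enqueues of [v], dequeues prophesying [v], and the rest, which become
   the noise threads. *)
have P : Permutation B (filter a B ++ filter d (filter (predC a) B)
                        ++ filter (predC d) (filter (predC a) B)).
  apply: Permutation_trans (Permutation_filterC a B) _.
  exact/Permutation_app_head/Permutation_filterC.
have GE := Forall_filter a G; have GC := Forall_filter (predC a) G.
have GD := Forall_filter d GC; have GK := Forall_filter (predC d) GC.
have sE : size (filter a B) = nb_enq v (history_of tr).
  by rewrite size_filter -nE count_map.
have sD : size (filter d (filter (predC a) B)) = nb_deq v (history_of tr).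
  rewrite -nD count_map size_filter count_filter; apply: eq_count => p /=.
  by rewrite /d /a /deq_call /enq_call; case: p.1 => //= r; rewrite andbT.
move: {P Rch nE nD} (reach_perm P Rch) sE sD GE GD GK.
move: (filter a B) (filter d _) (filter (predC d) _) => BE BD BK Rch sE sD GE GD GK.
exists v, (size BE), (size BD), (size BK); split; first by rewrite sE sD.
case: Rch => tr' [s' R']; exists tr', (s', map (fun p => p.2.2) (BE ++ BD ++ BK)); split.
  exists (map (fun p => [:: p.1]) (BE ++ BD ++ BK)); last first.
    rewrite -map_comp; move: R'; congr (run (_, _) _ _).
    have : List.Forall (fun p : item => p.2.1 = @start I [:: p.1]) (BE ++ BD ++ BK).
      rewrite !List.Forall_app; split; [|split].
      - by apply: List.Forall_impl GE => p [[]].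
      - by apply: List.Forall_impl GD => p [[[]]].
      - by apply: List.Forall_impl GK => p [[[]]].
    by elim=> //= p ps -> _ ->.
  rewrite /Prg !map_cat; apply: List.Forall2_app; [|apply: List.Forall2_app].
  - rewrite -(size_map (fun p : item => [:: p.1])); apply: Forall2_nseq.
    apply: (proj2 (List.Forall_map _ _ _)).
    apply: List.Forall_impl GE => -[c x] [[_ [/= nP _]]]; rewrite /a /enq_call /once /=.
    by case: c nP => [[y|]|r] //= _ /eqP->.
  - rewrite -(size_map (fun p : item => [:: p.1])); apply: Forall2_nseq.
    apply: (proj2 (List.Forall_map _ _ _)).
    apply: List.Forall_impl GD => -[c x] [_]; rewrite /d /deq_call /once /=.
    by case: c => //= r /eqP->.
  - rewrite -(size_map (fun p : item => [:: p.1])); apply: Forall2_nseq.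
    apply: (proj2 (List.Forall_map _ _ _)).
    apply: List.Forall_impl GK => -[c x] [[[_ [/= nP _]]]].
    rewrite /a /d /enq_call /deq_call /noise /=.
    case: c nP => [[y|]|r] //= _.
      by move=> /eqP yv _; left; exists y.
    by move=> _ /eqP rv; right; exists r.
rewrite /nb_deq_terminated /= !map_cat drop_size_cat ?size_map //.
rewrite take_size_cat ?size_map //.
(* By [good_item], all the [deq(v)] threads terminate. *)
have -> : count (@terminated I) (map (fun p => p.2.2) BD) = size BD.
  rewrite count_map; apply/eqP; rewrite -all_count.
  by elim: GD => //= p ps [[[_ [_ T]] _] dp] _ ->; rewrite T.
by rewrite sE sD; case/andP: Hnm.
Qed.

End Runs.

Theorem theorem6p1 (I : queue_impl) :
  completable I ->
  (~ VRepet I <->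
   forall v n m k : nat, 0 < n < m ->
     ~ exists (tr : trace) (g : config I),
         execution (Prg v n m k) tr g /\ n < nb_deq_terminated n m g).
Proof.
move=> _; split=> [nV v n m k nm [tr [g [ex lt]]]|H V].
  exact: nV (VRepet_of_Prg nm ex lt).
by have [v [n [m [k [nm ex]]]]] := Prg_of_VRepet V; apply: (H v n m k nm).
Qed.
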